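(* There are graph classes with row treewidth $1$ and unbounded geodesic treewidth.
   Context: All graphs are undirected, without loops and multi-edges. A geodesic in a graph $G$ is a path in $G$ that is a shortest path between its two endpoints (a single vertex is a geodesic). A partition $\mathcal{P}$ of $G$ is a set of induced subgraphs (parts) whose vertex sets partition $V(G)$; it is a partition into geodesics if the vertices of each part are exactly the vertices of a geodesic of $G$. The quotient $G/\mathcal{P}$ is the simple graph obtained from $G$ by contracting (identifying) each part into a single vertex, removing loops and multi-edges. The geodesic treewidth of $G$ is the smallest $k$ for which there is a partition $\mathcal{P}$ of $G$ into geodesics such that $G/\mathcal{P}$ has treewidth $k$. The row treewidth of $G$ is the smallest $k$ such that $G$ is isomorphic to a subgraph of the strong product $H \boxtimes P$ for some graph $H$ of treewidth $k$ and some path $P$. The row treewidth (respectively geodesic treewidth) of a graph class is the maximum of the row treewidth (respectively geodesic treewidth) over its members, and it is unbounded if no such maximum exists. *)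

(* Defs.v *)
From mathcomp Require Import all_boot.
From mathcomp Require Import boolp.

Set Implicit Arguments.
Unset Strict Implicit.
Unset Printing Implicit Defensive.

(* Finite simple graphs; the graph with no vertices is allowed. *)
Record sgraph := SGraph {
  vertex :> finType;
  adj : rel vertex;
  adj_sym : symmetric adj;
  adj_irr : irreflexive adj }.

Arguments adj {s}.

Lemma ex_asbool (Q : nat -> Prop) : (exists k, Q k) -> exists k, `[< Q k >].
Proof. by case=> k Qk; exists k; apply/asboolP. Qed.

Definition smallest (Q : nat -> Prop) (exQ : exists k, Q k) : nat :=
  ex_minn (ex_asbool exQ).

Lemma smallestP (Q : nat -> Prop) (exQ : exists k, Q k) :
  Q (smallest exQ) /\ forall j, Q j -> smallest exQ <= j.
Proof.
rewrite /smallest; case: ex_minnP => k /asboolP Qk mink; split=> // j Qj.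
by apply: mink; apply/asboolP.
Qed.

Definition connected_on (G : sgraph) (A : {set G}) : Prop :=
  {in A &, forall x y,
    connect [rel u v | [&& u \in A, v \in A & adj u v]] x y}.

Definition acyclic (G : sgraph) : Prop :=
  forall c : seq G, 3 <= size c -> ~ ucycle adj c.

Definition is_tree (G : sgraph) : Prop :=
  [/\ 0 < #|G|, connected_on [set: G] & acyclic G].

Definition is_tree_decomposition (G T : sgraph) (B : T -> {set G}) : Prop :=
  [/\ is_tree T,
      forall v : G, exists t, v \in B t,
      forall u v : G, adj u v -> exists t, (u \in B t) && (v \in B t)
    & forall v : G, connected_on [set t | v \in B t]].

(* The predecessor is truncated, so the graph with no vertices has width 0
   rather than -1. *)
Definition width (G T : sgraph) (B : T -> {set G}) : nat :=
  (\max_(t : T) #|B t|).-1.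

Definition has_tree_decomposition_of_width (G : sgraph) (k : nat) : Prop :=
  exists (T : sgraph) (B : T -> {set G}),
    is_tree_decomposition B /\ width B = k.

(* Vertices 0, ..., n, so n is the number of edges. *)
Definition path_adj (n : nat) : rel 'I_n.+1 :=
  fun i j => (i.+1 == j :> nat) || (j.+1 == i :> nat).

Lemma path_adj_sym n : symmetric (@path_adj n).
Proof. by move=> i j; rewrite /path_adj orbC. Qed.

Lemma path_adj_irr n : irreflexive (@path_adj n).
Proof. by move=> i; rewrite /path_adj orbb gtn_eqF. Qed.

Definition path_graph (n : nat) : sgraph :=
  SGraph (@path_adj_sym n) (@path_adj_irr n).

Lemma has_tree_decompositionE (G : sgraph) :
  exists k, has_tree_decomposition_of_width G k.
Proof.
exists (width (fun _ : path_graph 0 => [set: G])), (path_graph 0).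
exists (fun=> [set: G]); split=> //; split.
- split; first by rewrite card_ord.
    by move=> x y _ _; rewrite (ord1 x) (ord1 y) connect0.
  move=> c c3 /andP[_ /card_uniqP cE].
  by have := leq_trans c3 (eq_leq (esym cE)); rewrite ltnNge (leq_trans (max_card _)) ?card_ord.
- by move=> v; exists ord0; rewrite inE.
- by move=> u v _; exists ord0; rewrite !inE.
- by move=> v x y _ _; rewrite (ord1 x) (ord1 y) connect0.
Qed.

Definition treewidth (G : sgraph) : nat := smallest (has_tree_decompositionE G).

Section StrongProduct.
Variables G H : sgraph.

Definition strong_adj : rel (G * H)%type :=
  fun p q => [&& p != q, (p.1 == q.1) || adj p.1 q.1
                       & (p.2 == q.2) || adj p.2 q.2].

Lemma strong_adj_sym : symmetric strong_adj.
Proof.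
move=> p q; rewrite /strong_adj eq_sym [p.1 == _]eq_sym [p.2 == _]eq_sym.
by rewrite [adj p.1 _]adj_sym [adj p.2 _]adj_sym.
Qed.

Lemma strong_adj_irr : irreflexive strong_adj.
Proof. by move=> p; rewrite /strong_adj eqxx. Qed.

Definition strong_product : sgraph := SGraph strong_adj_sym strong_adj_irr.

End StrongProduct.

(* The subgraph need not be induced. *)
Definition isomorphic_to_subgraph (G H : sgraph) : Prop :=
  exists f : G -> H, injective f /\ {homo f : u v / adj u v}.

Definition has_row_structure (G : sgraph) (k : nat) : Prop :=
  exists (H : sgraph) (n : nat), treewidth H = k /\
    isomorphic_to_subgraph G (strong_product H (path_graph n)).

Lemma has_row_structureE (G : sgraph) : exists k, has_row_structure G k.
Proof.
exists (treewidth G), G, 0; split=> //; exists (fun u => (u, ord0)).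
split=> [u v [] //|u v uv]; rewrite /= /strong_adj /= uv orbT /= andbT.
by apply: contraTneq uv => -[->]; rewrite adj_irr.
Qed.

Definition row_treewidth (G : sgraph) : nat := smallest (has_row_structureE G).

(* A path is given by its first vertex x and the sequence p of the remaining
   ones; its length is size p. *)
Definition simple_path (G : sgraph) (x : G) (p : seq G) : bool :=
  path adj x p && uniq (x :: p).

Definition geodesic (G : sgraph) (x : G) (p : seq G) : Prop :=
  simple_path x p /\
  forall q, simple_path x q -> last x q = last x p -> size p <= size q.

Definition partition_into_geodesics (G : sgraph) (P : {set {set G}}) : Prop :=
  partition P [set: G] /\
  {in P, forall A : {set G}, exists (x : G) (p : seq G),
    geodesic x p /\ A = [set:: x :: p]}.

Section Quotient.
Variables (G : sgraph) (P : {set {set G}}).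

Definition quotient_adj : rel {A : {set G} | A \in P} :=
  fun A B => (A != B) && [exists x in val A, exists y in val B, adj x y].

Lemma quotient_adj_sym : symmetric quotient_adj.
Proof.
move=> A B; rewrite /quotient_adj eq_sym; congr (_ && _).
by apply/idP/idP => /exists_inP[x xA /exists_inP[y yB xy]];
  apply/exists_inP; exists y => //; apply/exists_inP; exists x => //;
  rewrite adj_sym.
Qed.

Lemma quotient_adj_irr : irreflexive quotient_adj.
Proof. by move=> A; rewrite /quotient_adj eqxx. Qed.

Definition quotient_graph : sgraph := SGraph quotient_adj_sym quotient_adj_irr.

End Quotient.

Definition has_geodesic_quotient (G : sgraph) (k : nat) : Prop :=
  exists P : {set {set G}},
    partition_into_geodesics P /\ treewidth (quotient_graph P) = k.

Lemma has_geodesic_quotientE (G : sgraph) : exists k, has_geodesic_quotient G k.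
Proof.
pose P := [set [set x] | x : G].
exists (treewidth (quotient_graph P)), P; split=> //; split.
  apply/and3P; split.
  - by apply/eqP/setP => x; rewrite cover_imset inE; apply/bigcupP; exists x; rewrite ?inE.
  - apply/trivIsetP => _ _ /imsetP[x _ ->] /imsetP[y _ ->] nxy.
    by rewrite disjoints1 inE; apply: contraNneq nxy => ->.
  - by apply/imsetP => -[x _ /setP/(_ x)]; rewrite !inE eqxx.
move=> _ /imsetP[x _ ->]; exists x, [::]; split; first by split.
by apply/setP => y; rewrite !inE.
Qed.

Definition geodesic_treewidth (G : sgraph) : nat :=
  smallest (has_geodesic_quotientE G).

Definition graph_class := sgraph -> Prop.

Definition class_parameter (f : sgraph -> nat) (C : graph_class) (k : nat) : Prop :=
  (exists G, C G /\ f G = k) /\ (forall G, C G -> f G <= k).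

Definition class_unbounded (f : sgraph -> nat) (C : graph_class) : Prop :=
  ~ exists k, class_parameter f C k.

(* Main.v *)
Require Import Defs.
From mathcomp Require Import all_boot zify.
From mathcomp Require Import boolp.

Set Implicit Arguments.
Unset Strict Implicit.
Unset Printing Implicit Defensive.

(* The witnesses are subdivided complete graphs.  The graph [web m] has a
   centre in each row 0, ..., m and, for each pair {i, j} of rows, a column (a
   path with one vertex per row) joined in rows i and j to the centres i and j.
   It lies in the strong product of a star, whose middle vertex carries the
   centres, and a path.  Two centres i and j are at distance |i - j| + 2, so a
   detour through a third centre costs at least two extra steps; hence a
   geodesic runs through boundedly many centres and columns.  The centre i
   together with all columns ending at it is a connected set, and any two of
   these m + 1 sets meet, so some bag of a tree decomposition of a quotient
   meets them all; as each part of a partition into geodesics meets at most 6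
   of them, the bag has more than m / 6 elements. *)

(** * Treewidth and row treewidth: basic bounds *)

Lemma treewidth_le (G T : sgraph) (B : T -> {set G}) :
  is_tree_decomposition B -> treewidth G <= width B.
Proof.
by move=> dB; apply: (smallestP (has_tree_decompositionE G)).2; exists T, B.
Qed.

Lemma row_treewidth_le (G H : sgraph) (n : nat) :
  isomorphic_to_subgraph G (strong_product H (path_graph n)) ->
  row_treewidth G <= treewidth H.
Proof.
by move=> iso; apply: (smallestP (has_row_structureE G)).2; exists H, n.
Qed.

Lemma treewidth0_adjF (H : sgraph) (u v : H) : treewidth H = 0 -> adj u v = false.
Proof.
move=> H0; have [[T [B [[_ _ edgeB _] wB]]] _] :=
  smallestP (has_tree_decompositionE H).
apply/negP => uv; have [t /andP[ut vt]] := edgeB _ _ uv.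
(* As [width] is a truncated predecessor, width 0 leaves bags of size 0 or 1. *)
have Bt : #|B t| <= 1.
  have le_max := @leq_bigmax _ (fun t => #|B t|) t.
  by move: wB le_max; rewrite -/(treewidth H) H0 /width; lia.
have := uv; rewrite (_ : u = v) ?adj_irr //.
by apply: (card_le1_eqP Bt).
Qed.

(** With row treewidth 0 the first factor has no edges, so every edge changes the row by exactly
    one; by parity there is no odd cycle. *)
Lemma row_treewidth_triangle (G : sgraph) (x y z : G) :
  adj x y -> adj y z -> adj z x -> 0 < row_treewidth G.
Proof.
move=> xy yz zx; rewrite lt0n; apply/eqP => G0.
have [[H [n [H0 [f [_ hom_f]]]]] _] := smallestP (has_row_structureE G).
rewrite -/(row_treewidth G) G0 in H0.
have row_adj u v : adj u v -> path_adj (f u).2 (f v).2.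
  move/hom_f/and3P => [fuv]; rewrite treewidth0_adjF // orbF => /eqP e1.
  case/orP => [/eqP e2|//]; case/negP: fuv.
  by rewrite [f u]surjective_pairing [f v]surjective_pairing e1 e2.
move: (row_adj _ _ xy) (row_adj _ _ yz) (row_adj _ _ zx).
rewrite /path_adj; move: (nat_of_ord (f x).2) (nat_of_ord (f y).2).
by move: (nat_of_ord (f z).2) => c a b; lia.
Qed.

Lemma connected_onP (G : sgraph) (A : {set G}) (z : G) :
  {in A, forall x,
    connect [rel u v | [&& u \in A, v \in A & adj u v]] z x} ->
  connected_on A.
Proof.
move=> zA x y xA yA; apply: connect_trans (zA y yA).
rewrite (sym_connect_sym _ x z); first exact: zA.
by move=> u v /=; rewrite adj_sym andbCA.
Qed.

(** * Stars *)

Section Star.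
Variable I : finType.

Definition star_adj : rel (option I) := fun x y => (x == None) (+) (y == None).

Lemma star_adj_sym : symmetric star_adj.
Proof. by move=> x y; rewrite /star_adj addbC. Qed.

Lemma star_adj_irr : irreflexive star_adj.
Proof. by move=> x; rewrite /star_adj addbb. Qed.

Definition star : sgraph := SGraph star_adj_sym star_adj_irr.

Lemma star_tree : is_tree star.
Proof.
split.
- by apply/card_gt0P; exists None.
- apply: (@connected_onP star _ None) => -[i|] _ //.
  by apply: connect1; rewrite /= !inE.
case=> [//|x [//|y [//|z s]]] _ /andP[].
(* [w] follows [z] on the cycle, so [w] is [x] for a triangle. Middle and leaves alternate, so [x]
   and [z], or [y] and [w], are both the middle vertex, against uniqueness. *)
have [w [ws cs]] : exists w, w \in x :: s /\ (cycle adj [:: x, y, z & s] ->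
  [&& adj x y, adj y z & adj z w]).
  case: s => [|w s]; [exists x|exists w]; rewrite !inE eqxx ?orbT; split=> //=.
    by case/and4P => -> -> ->.
  by case/and4P => -> -> ->.
move/cs => {cs}; rewrite /= /star_adj; move: ws; rewrite !inE.
case: x y z w => [x|] [y|] [z|] [w|] //= ws _.
by rewrite ws andbF.
Qed.

Lemma treewidth_star : treewidth star <= 1.
Proof.
pose B (t : star) : {set star} := [set None; t].
apply: (@leq_trans (width B)).
  apply: treewidth_le; split; first exact: star_tree.
  - by move=> v; exists v; rewrite !inE eqxx orbT.
  - case=> [u|] [v|] //; rewrite /= /star_adj //= => _.
      by exists (Some u); rewrite !inE eqxx.
    by exists (Some v); rewrite !inE !eqxx orbT.
  case=> [v|].
    suff -> : [set t | Some v \in B t] = [set Some v].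
      by move=> x y /set1P -> /set1P ->.
    by apply/setP => t; rewrite !inE eq_sym.
  suff -> : [set t | None \in B t] = [set: star] by case: star_tree.
  by apply/setP => t; rewrite !inE.
rewrite /width -subn1 leq_subLR; apply/bigmax_leqP => t _.
by rewrite cards2; case: (_ != _).
Qed.

End Star.

(** * Helly property of subtrees, and brambles *)

Lemma tree_edge_separates (T : sgraph) (t u : T) : acyclic T -> adj t u ->
  ~~ connect [rel x y | adj x y && ([set x; y] != [set t; u])] u t.
Proof.
move=> acT tu; apply/negP => /connectP[p0 p0_path].
case/shortenP: p0_path => p p_path p_uniq _ last_p.
(* The edge closes the path to a cycle, of length at least 3 because the path avoids that edge. *)
apply: (acT (u :: p)).
  case: p p_path {p_uniq} last_p => [|x [|y p]] //=.
    by move=> _ eq_tu; rewrite eq_tu adj_irr in tu.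
  by move=> /andP[/andP[_ /negP nut] _] eq_tx; case: nut; rewrite eq_tx setUC.
apply/andP; split=> //; rewrite /= rcons_path -last_p tu andbT.
by apply: sub_path p_path => x y /andP[].
Qed.

(* A periodic orbit of [f] has length at least 2, and is a cycle of [T] unless
   its length is 2. *)
Lemma tree_flip (T : sgraph) (f : T -> T) (t0 : T) : acyclic T ->
  (forall t, adj t (f t)) -> exists t, f (f t) = t.
Proof.
move=> acT adj_f.
have /trajectP[i lt_i iterE] : looping f t0 (order f t0) by apply: looping_order.
set x := iter i f t0 in iterE.
have x_per : exists k, iter k.+1 f x = x.
  exists (order f t0 - i).-1; rewrite prednK ?subn_gt0 // /x -iterD subnK 1?ltnW //.
have x_cycle : fcycle f (orbit f x) by apply/(orbitPcycle 0 3).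
apply: contrapT => nflip; apply: (acT (orbit f x)); last first.
  apply/andP; split; last exact: orbit_uniq.
  by apply: sub_cycle x_cycle => y z /eqP <-.
rewrite size_orbit; move: x_cycle; rewrite /orbit.
have := order_gt0 f x; case: (order f x) => [|[|[|k]]] //= _.
  by rewrite andbT => /eqP fx; have := adj_f x; rewrite fx adj_irr.
by rewrite eqxx andbT => /= /eqP fx; case: nflip; exists x.
Qed.

(** Otherwise each vertex [t] misses some [A i], which by connectedness lies beyond a single
    neighbour [f t]. On an edge flipped by [f], two of the sets lie on opposite sides, yet they
    meet. *)
Lemma tree_helly (T : sgraph) (I : finType) (A : I -> {set T}) : is_tree T ->
  (forall i, connected_on (A i)) ->
  (forall i j, exists t, (t \in A i) && (t \in A j)) ->
  exists t, forall i, t \in A i.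
Proof.
case=> /card_gt0P[t0 _] connT acT connA meetA; apply: contrapT => noT.
have missed t : exists i, t \notin A i.
  apply: contrapT => nt; apply: noT; exists t => i.
  by apply: contrapT => /negP ti; apply: nt; exists i.
have step t : exists u, adj t u /\ exists2 i, t \notin A i &
    {in A i, forall w, connect [rel x y | [&& x != t, y != t & adj x y]] u w}.
  have [i ti] := missed t; have [w /andP[wi _]] := meetA i i.
  have /connectP[p0 p0_path] := connT t w (in_setT _) (in_setT _).
  case/shortenP: p0_path => p p_path p_uniq _ last_p.
  case: p p_path p_uniq last_p => [_ _ /= wt|u p /=].
    by rewrite -wt wi in ti.
  rewrite !inE /= => /andP[tu p_path] /and3P[/norP[ntu ntp] _ _] last_p.
  (* [u] is the first step of a simple path from [t] to [w] in [A i]. The rest of the path and all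
     of [A i] avoid [t]. *)
  exists u; split=> //; exists i => // w' w'i.
  apply: (@connect_trans _ _ w); last first.
    have := connA i w w' wi w'i; apply: connect_sub => x y /and3P[xi yi xy].
    by apply: connect1; rewrite /= xy andbT; apply/andP; split;
      [move: xi|move: yi]; apply: contraTneq => ->.
  apply/connectP; exists p => //.
  have ntup : all (fun z => z != t) (u :: p).
    by rewrite /= eq_sym ntu; apply/allP => z zp; apply: contraNneq ntp => <-.
  apply: (@sub_in_path _ (predC1 t)) ntup p_path.
  by move=> x y xt yt /and3P[_ _ xy]; apply/and3P.
have [f f_step] := choice step.
have [t ftt] := tree_flip t0 acT (fun t => (f_step t).1).
have [tu [i ti ui]] := f_step t; have [_ [j uj tj]] := f_step (f t).
have [w /andP[wi wj]] := meetA i j; rewrite ftt in tj.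
(* The walk from [f t] to [w] avoids [t], and the one from [w] to [t] avoids [f t], so neither uses
   the edge between them. *)
have /negP[] := tree_edge_separates acT tu.
apply: (@connect_trans _ _ w).
  have := ui w wi; apply: connect_sub => x y /and3P[xt yt xy].
  apply: connect1; rewrite /= xy; apply/eqP => /setP/(_ t).
  by rewrite !inE eqxx eq_sym (negPf xt) eq_sym (negPf yt).
have := tj w wj; rewrite (sym_connect_sym _ t w); last first.
  by move=> x y /=; rewrite adj_sym andbCA.
apply: connect_sub => x y /and3P[xt yt xy].
apply: connect1; rewrite /= xy; apply/eqP => /setP/(_ (f t)).
by rewrite !inE eqxx orbT eq_sym (negPf xt) eq_sym (negPf yt).
Qed.

(** The nodes whose bags meet [A i] form a connected set, since consecutive vertices of a path in
    [A i] share a bag. These sets pairwise meet, so the Helly property applies. *)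
Lemma bramble_bag (G T : sgraph) (B : T -> {set G}) (I : finType)
    (A : I -> {set G}) : is_tree_decomposition B ->
  (forall i, connected_on (A i)) ->
  (forall i j, exists x, (x \in A i) && (x \in A j)) ->
  exists t, forall i, exists2 x, x \in B t & x \in A i.
Proof.
case=> treeT vertB edgeB connB connA meetA.
pose M i : {set T} := [set t | [exists x in B t, x \in A i]].
have [||t tM] := @tree_helly T I M treeT.
- move=> i s t; rewrite !inE => /exists_inP[x xs xi] /exists_inP[y yt yi].
  have same z u v : z \in A i -> z \in B u -> z \in B v ->
      connect [rel u v | [&& u \in M i, v \in M i & adj u v]] u v.
    move=> zi zu zv; have := connB z u v; rewrite !inE => /(_ zu zv).
    apply: connect_sub => a b; rewrite /= !inE => /and3P[za zb ab].
    apply: connect1; rewrite /= !inE ab andbT.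
    by apply/andP; split; apply/exists_inP; exists z.
  have /connectP[p p_path y_last] := connA i x y xi yi.
  elim: p x s xs xi p_path y_last => [|z p IHp] x s xs xi /=.
    by move=> _ yx; rewrite yx in yt; apply: same xs yt.
  move=> /andP[/and3P[_ zi /edgeB[r /andP[xr zr]]] p_path] y_last.
  exact: connect_trans (same x s r xi xs xr) (IHp z r zr zi p_path y_last).
- move=> i j; have [x /andP[xi xj]] := meetA i j; have [t xt] := vertB x.
  by exists t; rewrite !inE; apply/andP; split; apply/exists_inP; exists x.
by exists t => i; have := tM i; rewrite inE => /exists_inP[x xt xi]; exists x.
Qed.

(** * Connectivity in quotients, and shortest paths *)

Lemma quotient_connected (G : sgraph) (P : {set {set G}}) (S : {set G}) :
  partition P [set: G] -> connected_on S ->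
  connected_on [set A : quotient_graph P | ~~ [disjoint val A & S]].
Proof.
move=> partP connS A A'; rewrite !inE => /pred0Pn[x /andP[/= xA xS]].
move=> /pred0Pn[y /andP[/= yA' yS]].
have /connectP[p p_path y_last] := connS x y xS yS.
elim: p x A xA xS p_path y_last => [|z p IHp] x A xA xS /=.
  move=> _ yx; rewrite (_ : A' = A) //; apply: val_inj => /=.
  rewrite yx in yA'; case/and3P: partP => _ trivP _.
  by rewrite -(def_pblock trivP (valP A) xA) -(def_pblock trivP (valP A') yA').
move=> /andP[/and3P[_ zS xz] p_path] y_last.
have zP : z \in cover P by case/and3P: partP => /eqP -> _ _; rewrite inE.
(* The part of the next vertex [z] is [A] itself or adjacent to [A]. *)
pose C : quotient_graph P := exist _ (pblock P z) (pblock_mem zP).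
have zC : z \in val C by rewrite /= mem_pblock.
have := IHp z C zC zS p_path y_last; apply: connect_trans.
have [->|neAC] := eqVneq A C; first exact: connect0.
apply: connect1; rewrite /= !inE; apply/and3P; split.
- by apply/pred0Pn; exists x; rewrite /= xA.
- by apply/pred0Pn; exists z; rewrite /= zS andbT.
by rewrite /quotient_adj neAC; apply/exists_inP; exists x => //;
  apply/exists_inP; exists z.
Qed.

(** The competitors [q] are arbitrary walks, so a detour can be used without checking that it is
    simple. *)
Definition shortest (G : sgraph) (x : G) (p : seq G) : Prop :=
  forall q, path adj x q -> last x q = last x p -> size p <= size q.

Lemma geodesic_shortest (G : sgraph) (x : G) (p : seq G) :
  geodesic x p -> shortest x p.
Proof.
case=> _ short_p q0 q0_path.
case: (shortenP q0_path) => q q_path q_uniq sub_q last_q.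
apply: leq_trans (short_p q _ last_q) _; first exact/andP.
by apply: uniq_leq_size => //; case/andP: q_uniq.
Qed.

Lemma shortest_behead (G : sgraph) (x y : G) (p : seq G) :
  adj x y -> shortest x (y :: p) -> shortest y p.
Proof.
by move=> xy short q q_path last_q; apply: (short (y :: q)); rewrite //= xy.
Qed.

Lemma shortest_catl (G : sgraph) (x : G) (p q : seq G) :
  path adj x (p ++ q) -> shortest x (p ++ q) -> shortest x p.
Proof.
rewrite cat_path => /andP[_ q_path] short r r_path last_r.
have := short (r ++ q); rewrite cat_path last_r r_path q_path !last_cat last_r.
by rewrite !size_cat leq_add2r; apply.
Qed.

(** * The webs and their bramble sets *)

Section Web.
Variable m : nat.

(* [(None, i)] is the centre in row [i], and [(Some e, i)] is the vertex of the
   column of the pair [e] in row [i]. *)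
Let site := (option ('I_m.+1 * 'I_m.+1) * 'I_m.+1)%type.

(** The indices of the bramble sets containing [u]; on a column they do not depend on the row. *)
Definition ends (u : site) : {set 'I_m.+1} :=
  if u.1 is Some e then [set e.1; e.2] else [set u.2].

Definition web_adj : rel site := fun u v =>
  match u.1, v.1 with
  | None, None => false
  | None, Some _ => (u.2 == v.2) && (u.2 \in ends v)
  | Some _, None => (u.2 == v.2) && (v.2 \in ends u)
  | Some e, Some e' => (e == e') && path_adj u.2 v.2
  end.

Lemma web_adj_sym : symmetric web_adj.
Proof.
move=> [[e|] i] [[e'|] j] //; rewrite /web_adj /= 1?[j == i]eq_sym //.
by rewrite path_adj_sym [e == _]eq_sym.
Qed.

Lemma web_adj_irr : irreflexive web_adj.
Proof. by move=> [[e|] i]; rewrite /web_adj //= path_adj_irr andbF. Qed.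

Definition web : sgraph := SGraph web_adj_sym web_adj_irr.

Lemma web_in_star_path :
  isomorphic_to_subgraph web
    (strong_product (star ('I_m.+1 * 'I_m.+1)%type) (path_graph m)).
Proof.
exists id; split=> // u v uv; apply/and3P; split.
- by apply: contraTneq uv => ->; rewrite adj_irr.
- case: u v uv => [[e|] i] [[e'|] j] //=; rewrite /web_adj /=.
    by case/andP => /eqP -> _; rewrite eqxx.
case: u v uv => [[e|] i] [[e'|] j] //=; rewrite /web_adj /=.
- by case/andP => _ ->; rewrite orbT.
- by case/andP => ->.
by case/andP => ->.
Qed.

(** Subtraction is truncated, so this is |i - j|. *)
Definition row_dist (i j : nat) := (i - j) + (j - i).

Lemma column_path (e : 'I_m.+1 * 'I_m.+1) (i j : 'I_m.+1) :
  exists p : seq web, [/\ path (@adj web) (Some e, i) p,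
    last (Some e, i) p = (Some e, j), size p = row_dist i j & all (fun u => u.1 == Some e) p].
Proof.
move dE : (row_dist i j) => d; elim: d i dE => [|d IHd] i dE.
  exists [::]; split=> //=; congr (_, _); apply: val_inj.
  by move: dE; rewrite /row_dist /=; lia.
have [k ik kj] : exists2 k : 'I_m.+1, path_adj i k & row_dist k j = d.
  move: dE (ltn_ord i) (ltn_ord j); rewrite /row_dist /path_adj.
  case: (ltnP i j) => ij dE im jm.
    have km : i.+1 < m.+1 by lia.
    by exists (Ordinal km) => /=; lia.
  have km : i.-1 < m.+1 by lia.
  by exists (Ordinal km) => /=; lia.
have [p [p_path last_p size_p col_p]] := IHd k kj.
exists ((Some e, k) :: p); split=> //=; last by rewrite eqxx.
  by rewrite p_path andbT /web_adj /= eqxx.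
by rewrite size_p.
Qed.

Definition bramble_set (i : 'I_m.+1) : {set web} := [set u | i \in ends u].

Lemma bramble_set_connected i : connected_on (bramble_set i).
Proof.
apply: (@connected_onP web _ (None, i)) => -[[e|] j];
  rewrite !inE /ends /=; last first.
  by move/eqP ->.
move=> ie; have ie_set : i \in [set e.1; e.2] by rewrite !inE.
have [p [p_path last_p _ col_p]] := column_path e i j.
apply/connectP; exists ((Some e, i) :: p); last by rewrite /= last_p.
have col_in k : (Some e, k) \in bramble_set i by rewrite inE.
have centre_in : (None, i) \in bramble_set i by rewrite !inE.
rewrite /= centre_in col_in /web_adj /= eqxx ie_set /=.
have col_e : all (fun u : web => u.1 == Some e) ((Some e, i) :: p).
  by rewrite /= eqxx.
apply: (@sub_in_path _ (fun u : web => u.1 == Some e)) col_e p_path.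
move=> [c k] [c' k'] /eqP /= -> /eqP /= -> uv.
by rewrite /= !col_in.
Qed.

Lemma bramble_set_meet i j :
  exists u, (u \in bramble_set i) && (u \in bramble_set j).
Proof. by exists (Some (i, j), i); rewrite !inE !eqxx orbT. Qed.

(** * Centres and ends on a geodesic *)

Definition centre (u : web) : bool := u.1 == None.

(* Every centre other than the starting point is entered by a step that stays
   in its row, and is left by another one. *)
Lemma path_size_ge (x : web) (p : seq web) : path adj x p ->
  row_dist x.2 (last x p).2 + 2 * count centre p <= size p + ~~ centre x.
Proof.
elim: p x => [|y p IHp] x /=; first by rewrite /row_dist; lia.
case/andP => + /IHp; move: (count _ _) (size _) (last _ _).2 => c s l.
case: x y => [[e|] i] [[e'|] j]; rewrite /web_adj /centre /row_dist //=.
- by case/andP => _; rewrite /path_adj; lia.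
- by case/andP => /eqP ->; lia.
by case/andP => /eqP ->; lia.
Qed.

Lemma centre_dist (i j : 'I_m.+1) (p : seq web) :
  @shortest web (None, i) p -> last (None, i) p = (None, j) ->
  size p <= row_dist i j + 2.
Proof.
move=> short last_p; have [q [q_path last_q size_q _]] := column_path (i, j) i j.
(* Enter the column of [(i, j)], follow it to row [j], leave it: two steps more than the row
   distance. *)
have := short ((Some (i, j), i) :: rcons q (None, j)).
rewrite /= rcons_path q_path last_q last_rcons last_p size_rcons size_q addn2.
by apply=> //; rewrite /web_adj /= !eqxx !inE !eqxx orbT.
Qed.

(** Counting the start, there are at most two centres. From a first centre to the last one,
    [path_size_ge] and [centre_dist] together leave room for only one centre after the first. *)
Lemma shortest_centre_count (x : web) (p : seq web) :
  path adj x p -> shortest x p -> count centre p <= 2 - centre x.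
Proof.
elim: p x => [//|y p IHp] x p_path short.
have [cx|ncx] := boolP (centre x); last first.
  have /andP[xy yp_path] := p_path.
  have := IHp y yp_path (@shortest_behead web _ _ _ xy short).
  by rewrite /=; case: (centre y) => /=; lia.
move: {y p IHp}(y :: p) p_path short => p p_path short.
have [|] := boolP (has centre p); last by rewrite has_count; lia.
(* Splitting the reversed path at its first centre yields the last centre [c] of [p]. *)
rewrite -has_rev => /split_find; case rev_p : _ _ _ / => [c s1 s2 cc ns1].
have {rev_p}p_eq : p = rcons (rev s2) c ++ rev s1.
  by rewrite -[p]revK rev_p rev_cat rev_rcons cat_rcons.
rewrite {p}p_eq in p_path short *.
rewrite count_cat count_rev (_ : count centre s1 = 0); last first.
  by move: ns1; rewrite has_count; lia.
have short1 := shortest_catl p_path short.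
move: p_path; rewrite cat_path => /andP[/path_size_ge + _].
case: x cx short1 {short} => [[//|] i] _ short1.
case: c cc short1 => [[//|] j] _ short1.
have := centre_dist short1; rewrite last_rcons => /(_ _ erefl).
by rewrite /centre /=; lia.
Qed.

Lemma card_ends (u : web) : #|ends u| <= 2.
Proof. by case: u => [[e|] i]; rewrite /ends /= ?cards1 ?cards2 //; case: eqP. Qed.

(** Going backwards along the path, [ends x] can add indices only when [x] lies on a column and the
    next vertex is a centre; it then adds at most 2. *)
Lemma path_ends (x : web) (p : seq web) : path adj x p ->
  #|\bigcup_(u <- x :: p) ends u| <= 2 + 2 * count centre p.
Proof.
elim: p x => [|y p IHp] x /=; first by rewrite big_seq1 card_ends.
case/andP => xy /IHp; rewrite [X in _ -> #|pred_of_set X| <= _]big_cons.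
have [sub_xy|] := boolP (ends x \subset ends y).
  have /setUidPr -> : ends x \subset \bigcup_(u <- y :: p) ends u.
    by rewrite big_cons; apply: subset_trans sub_xy (subsetUl _ _).
  by move/leq_trans; apply; rewrite leq_add2l leq_mul2l leq_addl.
have := card_ends x.
have [+ _] := leq_card_setU (ends x) (\bigcup_(u <- y :: p) ends u).
case: x y xy => [[e|] i] [[e'|] j]; rewrite /web_adj /ends /centre //=.
- by case/andP => /eqP ->; rewrite subxx.
- by lia.
by case/andP => _ ie'; rewrite sub1set ie'.
Qed.

Lemma geodesic_ends (x : web) (p : seq web) : geodesic x p ->
  #|\bigcup_(u in [set:: x :: p]) ends u| <= 6.
Proof.
move=> geo; have short := geodesic_shortest geo.
case: geo => /andP[p_path _] _.
have le_count := shortest_centre_count p_path short.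
(* At most two centres after the start give 2 + 2 * 2 = 6. *)
apply: leq_trans (_ : 2 + 2 * count centre p <= 6); last by lia.
apply: leq_trans (path_ends p_path); apply: subset_leq_card.
apply/bigcupsP => u; rewrite inE => ux.
by rewrite (big_rem u) //= subsetUl.
Qed.

(** * The lower bound on geodesic treewidth *)

Lemma web_quotient_treewidth (P : {set {set web}}) :
  partition_into_geodesics P -> m < 6 * (treewidth (quotient_graph P)).+1.
Proof.
case=> partP geoP.
have [[T [B [decB widthB]]] _] :=
  smallestP (has_tree_decompositionE (quotient_graph P)).
rewrite -/(treewidth _) in widthB; rewrite -widthB.
pose A i := [set C : quotient_graph P | ~~ [disjoint val C & bramble_set i]].
have [||t tA] := @bramble_bag _ _ B _ A decB.
- by move=> i; apply: quotient_connected (@bramble_set_connected i).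
- move=> i j; have [u /andP[ui uj]] := bramble_set_meet i j.
  have uP : u \in cover P by case/and3P: partP => /eqP -> _ _; rewrite inE.
  exists (exist _ (pblock P u) (pblock_mem uP)); rewrite !inE /=.
  by apply/andP; split; apply/pred0Pn; exists u; rewrite /= mem_pblock uP.
(* The bag [B t] meets all bramble sets, so its parts together carry every index. *)
have cover_ends : [set: 'I_m.+1] \subset
    \bigcup_(C in B t) \bigcup_(u in val C) ends u.
  apply/subsetP => i _; have [C CB] := tA i.
  rewrite inE => /pred0Pn[u /andP[/= uC]]; rewrite inE => iu.
  by apply/bigcupP; exists C => //; apply/bigcupP; exists u.
have := subset_leq_card cover_ends; rewrite cardsT card_ord => le_m.
have sum_le : m.+1 <= \sum_(C in B t) 6.
  apply: leq_trans le_m _.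
  elim/big_ind2: _ => [|S a S' b Sa Sb|C _]; first by rewrite cards0.
    exact: leq_trans (leq_card_setU _ _).1 (leq_add Sa Sb).
  by have [x [p [geo ->]]] := geoP _ (valP C); apply: geodesic_ends.
apply: leq_trans sum_le _; rewrite sum_nat_const mulnC leq_mul2l /=.
by apply: leq_trans (leqSpred _); apply: (leq_bigmax t).
Qed.

Lemma web_geodesic_treewidth : m < 6 * (geodesic_treewidth web).+1.
Proof.
have [[P [geoP tw]] _] := smallestP (has_geodesic_quotientE web).
by rewrite /geodesic_treewidth -tw; apply: web_quotient_treewidth.
Qed.

End Web.

(** * The graph class *)

Lemma row_treewidth_star_path :
  row_treewidth (strong_product (star unit) (path_graph 1)) = 1.
Proof.
set G := strong_product _ _; apply/eqP; rewrite eqn_leq; apply/andP; split.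
  apply: leq_trans (treewidth_star unit); apply: (@row_treewidth_le _ _ 1).
  by exists id; split=> // u v.
(* Both factors are single edges, so [G] is complete on four vertices. *)
by apply: (@row_treewidth_triangle G (None, ord0) (Some tt, ord0) (None, ord_max)).
Qed.

Theorem corollary8 :
  exists C : graph_class,
    class_parameter row_treewidth C 1 /\ class_unbounded geodesic_treewidth C.
Proof.
(* Taking all graphs of row treewidth at most 1 makes the upper bound immediate; one member must
   attain it. *)
exists (fun G => row_treewidth G <= 1); split.
  split=> //; exists (strong_product (star unit) (path_graph 1)).
  by rewrite row_treewidth_star_path.
case=> k [_ gtw_le].
(* For m = 6(k + 1), [web_geodesic_treewidth] forces a value above [k]. *)
have row_web : row_treewidth (web (6 * k.+1)) <= 1.
  exact: leq_trans (row_treewidth_le (@web_in_star_path _)) (treewidth_star _).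
have := web_geodesic_treewidth (6 * k.+1); have := gtw_le _ row_web; lia.
Qed.
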